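(* Let $\tilde g_0,\tilde g_1\in PGL(3,\mathbb{T})$ be the tropical linear transformations given in the inhomogeneous coordinate by $$\tilde g_0:(X,Y)\mapsto(Y,X),\qquad \tilde g_1:(X,Y)\mapsto(Y-X,-X).$$ They satisfy $\tilde g_0^2=\tilde g_1^3=(\tilde g_0\tilde g_1)^2=1$, and the dihedral group of degree three $$\mathcal{D}_3=\langle\tilde g_0,\tilde g_1\rangle\simeq(\mathbb{Z}/3\mathbb{Z})\rtimes\left\langle\begin{pmatrix}2&0\\0&2\end{pmatrix}\right\rangle,\qquad \begin{pmatrix}2&0\\0&2\end{pmatrix}\in SL(2,\mathbb{F}_3),$$ is the group of linear automorphisms acting on the tropical Hesse pencil $\{C_\kappa\}_\kappa$. The action of $\tilde g_0$ on each curve of the pencil is realized as the reflection with respect to the line $Y=X$ passing through the vertex $V_1=(\kappa,\kappa)$, and the action of $\tilde g_1$ on each curve is realized as the addition with $V_3=(0,-\kappa)$, i.e. $\tilde g_1(P)=P+V_3$ for all $P\in\bar C_\kappa$, $0<\kappa<\infty$.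
   Context: Tropical linear transformations. $\mathbb{T}=\mathbb{R}\cup\{-\infty\}$ is the max-plus semifield (addition is $\max$, multiplication is $+$). $PGL(3,\mathbb{T})$ is the group of invertible $3\times3$ matrices over $\mathbb{T}$ modulo tropical scalars (addition of a common real constant to all entries). It acts by tropical matrix-vector multiplication on homogeneous coordinates $(\tilde x_0,\tilde x_1,\tilde x_2)\in\mathbb{R}^3$ taken modulo $\mathbb{R}(1,1,1)$. The inhomogeneous coordinate is $(X,Y)=(\tilde x_1-\tilde x_0,\tilde x_2-\tilde x_0)\in\mathbb{R}^2$. In homogeneous coordinates $\tilde g_0:(\tilde x_0,\tilde x_1,\tilde x_2)\mapsto(\tilde x_0,\tilde x_2,\tilde x_1)$ and $\tilde g_1:(\tilde x_0,\tilde x_1,\tilde x_2)\mapsto(\tilde x_1,\tilde x_2,\tilde x_0)$. Tropical Hesse pencil. For $\kappa\in\mathbb{R}$, $C_\kappa\subset\mathbb{R}^2$ is the set of points at which $F(X,Y;\kappa)=\max(3X,3Y,0,\kappa+X+Y)$ is not differentiable in $(X,Y)$. The tropical Hesse pencil is the family $\{C_\kappa\}_\kappa$. The group of linear automorphisms acting on the pencil is the group of all $g\in PGL(3,\mathbb{T})$ whose action on $\mathbb{R}^2$ maps every member of the pencil onto a member of the pencil. Group structure on the curves. For $0<\kappa<\infty$, $\bar C_\kappa$ denotes $C_\kappa$ with its unbounded edges removed (keeping their end vertices): it is the boundary of the triangle with vertices $V_1=(\kappa,\kappa)$, $V_2=(-\kappa,0)$, $V_3=(0,-\kappa)$. It carries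 an additive group structure with unit $V_1$, transported from $J(C_\kappa)=\mathbb{R}/3\kappa\mathbb{Z}$ by the bijection $\tilde\varphi:J(C_\kappa)\to\bar C_\kappa$ given for $0\le t\le\kappa$ by $\tilde\varphi(t)=(\kappa-2t,\kappa-t)$, $\tilde\varphi(\kappa+t)=(-\kappa+t,-t)$, $\tilde\varphi(2\kappa+t)=(t,-\kappa+2t)$. In particular $\tilde\varphi(0)=V_1$, $\tilde\varphi(\kappa)=V_2$, $\tilde\varphi(2\kappa)=V_3$. Semi-direct product. $\left\langle\begin{pmatrix}2&0\\0&2\end{pmatrix}\right\rangle$ is the subgroup of order two of $SL(2,\mathbb{F}_3)$. For $\gamma_1,\gamma_2\in\mathbb{Z}/3\mathbb{Z}$ and $m_1,m_2$ in this subgroup, the multiplication is $(\gamma_1,m_1)\cdot(\gamma_2,m_2)=(\gamma_1+m_1\gamma_2,\,m_1m_2)$, where $\gamma_i$ is identified with $(\gamma_i,0)\in(\mathbb{Z}/3\mathbb{Z})^2$. *)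

(* Defs.v *)
From HB Require Import structures.
From mathcomp Require Import all_boot all_order all_algebra all_fingroup.
From mathcomp Require Import all_solvable.
From mathcomp Require Import ring lra zify.
From mathcomp Require Import generic_quotient ring_quotient.
From mathcomp Require Import all_classical all_reals all_analysis.
Import numFieldNormedType.Exports.
Import Order.TTheory GRing.Theory Num.Theory.

Set Implicit Arguments.
Unset Strict Implicit.
Unset Printing Implicit Defensive.

Local Open Scope quotient_scope.
Local Open Scope classical_set_scope.
Local Open Scope ring_scope.

(* The max-plus semifield: None is -oo, and Some x is the real number x.
   Its ring_scope operations are the tropical ones: + is max, * is the sum of
   reals, 0 is -oo and 1 is the real number 0. *)
Definition trop (R : realType) : Type := option R.

Section TropSemiring.
Variable R : realType.
Implicit Types x y : trop R.

HB.instance Definition _ := Choice.on (trop R).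

Definition trop_add x y : trop R :=
  match x, y with
  | Some a, Some b => Some (Num.max a b)
  | None, _ => y
  | _, None => x
  end.

Definition trop_mul x y : trop R :=
  match x, y with Some a, Some b => Some (a + b) | _, _ => None end.

Fact trop_addA : associative trop_add.
Proof. by move=> [a|] [b|] [c|] //=; rewrite maxA. Qed.

Fact trop_addC : commutative trop_add.
Proof. by move=> [a|] [b|] //=; rewrite maxC. Qed.

Fact trop_add0 : left_id (None : trop R) trop_add.
Proof. by []. Qed.

Fact trop_mulA : associative trop_mul.
Proof. by move=> [a|] [b|] [c|] //=; rewrite addrA. Qed.

Fact trop_mulC : commutative trop_mul.
Proof. by move=> [a|] [b|] //=; rewrite addrC. Qed.

Fact trop_mul1 : left_id (Some 0 : trop R) trop_mul.
Proof. by move=> [a|] //=; rewrite add0r. Qed.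

Fact trop_mulDl : left_distributive trop_mul trop_add.
Proof. by move=> [a|] [b|] [c|] //=; rewrite addr_maxl. Qed.

Fact trop_mul0 : left_zero (None : trop R) trop_mul.
Proof. by []. Qed.

HB.instance Definition _ :=
  GRing.isNmodule.Build (trop R) trop_addA trop_addC trop_add0.
HB.instance Definition _ := GRing.Nmodule_isComNzSemiRing.Build (trop R)
  trop_mulA trop_mulC trop_mul1 trop_mulDl trop_mul0 isT.

End TropSemiring.

Section TropPGL.
Variables (R : realType) (n : nat).
Local Notation T := (trop R).

Definition trop_inverse (A B : 'M[T]_n) : Prop := A *m B = 1%:M /\ B *m A = 1%:M.

Definition trop_invertible : {pred 'M[T]_n} :=
  fun A => `[< exists B, trop_inverse A B >].

Record tropGL := TropGL
  { tropGL_val :> 'M[T]_n; tropGL_valP : tropGL_val \in trop_invertible }.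
HB.instance Definition _ := [isSub for tropGL_val].
HB.instance Definition _ := [Choice of tropGL by <:].

Fact trop_invertible1 : (1%:M : 'M[T]_n) \in trop_invertible.
Proof. by apply/asboolP; exists 1%:M; split; rewrite mulmx1. Qed.

Fact trop_invertibleM (A B : tropGL) : A *m B \in trop_invertible.
Proof.
case: A B => [A /= /asboolP[A' [AA' A'A]]] [B /= /asboolP[B' [BB' B'B]]].
apply/asboolP; exists (B' *m A'); split.
  by rewrite mulmxA -(mulmxA A) BB' mulmx1.
by rewrite mulmxA -(mulmxA B') A'A mulmx1.
Qed.

Definition tropGL_inv_mx (A : tropGL) : 'M[T]_n :=
  sval (cid (asboolW (tropGL_valP A))).

Fact tropGL_inv_mxP (A : tropGL) : trop_inverse A (tropGL_inv_mx A).
Proof. by rewrite /tropGL_inv_mx; case: cid. Qed.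

Fact trop_invertibleV (A : tropGL) : tropGL_inv_mx A \in trop_invertible.
Proof.
by apply/asboolP; exists A; case: (tropGL_inv_mxP A) => ? ?; split.
Qed.

Definition tropGL_one := TropGL trop_invertible1.
Definition tropGL_mul A B := TropGL (trop_invertibleM A B).
Definition tropGL_inv A := TropGL (trop_invertibleV A).

Fact tropGL_mulA : associative tropGL_mul.
Proof. by move=> A B C; apply: val_inj; rewrite /= mulmxA. Qed.

Fact tropGL_mul1g : left_id tropGL_one tropGL_mul.
Proof. by move=> A; apply: val_inj; rewrite /= mul1mx. Qed.

Fact tropGL_mulg1 : right_id tropGL_one tropGL_mul.
Proof. by move=> A; apply: val_inj; rewrite /= mulmx1. Qed.

Fact tropGL_mulVg : left_inverse tropGL_one tropGL_inv tropGL_mul.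
Proof. by move=> A; apply: val_inj; case: (tropGL_inv_mxP A). Qed.

Fact tropGL_mulgV : right_inverse tropGL_one tropGL_inv tropGL_mul.
Proof. by move=> A; apply: val_inj; case: (tropGL_inv_mxP A). Qed.

HB.instance Definition _ := isGroup.Build tropGL
  tropGL_mulA tropGL_mul1g tropGL_mulg1 tropGL_mulVg tropGL_mulgV.

Definition trop_scal_equiv (A B : tropGL) : bool :=
  `[< exists c : R, val B = (Some c : T) *: val A >].

Fact trop_scal_equivP : equiv_class_of trop_scal_equiv.
Proof.
have symP A B : trop_scal_equiv A B -> trop_scal_equiv B A.
  move=> /asboolP[c AB]; apply/asboolP; exists (- c); rewrite AB scalerA.
  have -> : (Some (- c) : T) * (Some c : T) = 1.
    by congr Some; rewrite addNr.
  by rewrite scale1r.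
split=> [A|A B|B A C].
- by apply/asboolP; exists 0; rewrite scale1r.
- by apply/idP/idP; apply: symP.
- move=> /asboolP[c AB] /asboolP[d BC]; apply/asboolP; exists (d + c).
  by rewrite BC AB scalerA.
Qed.

Canonical trop_scal_equiv_equiv := EquivRelPack trop_scal_equivP.
Canonical trop_scal_equiv_encModRel := defaultEncModRel trop_scal_equiv.

Definition tropPGL : Type := {eq_quot trop_scal_equiv}.
HB.instance Definition _ : EqQuotient tropGL trop_scal_equiv tropPGL :=
  EqQuotient.on tropPGL.
HB.instance Definition _ := Choice.on tropPGL.

Definition tropPGL_class (A : tropGL) : tropPGL := \pi_tropPGL A.

Definition tropPGL_one : tropPGL := tropPGL_class 1%g.
Definition tropPGL_mul (g h : tropPGL) : tropPGL :=
  tropPGL_class (repr g * repr h)%g.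
Definition tropPGL_inv (g : tropPGL) : tropPGL := tropPGL_class (repr g)^-1%g.

Lemma tropPGL_classP (A B : tropGL) :
  tropPGL_class A = tropPGL_class B <->
  exists c : R, val B = (Some c : T) *: val A.
Proof.
split=> [/eqmodP/asboolP //|AB].
by apply/eqmodP/asboolP.
Qed.

Lemma tropPGL_mulE A B :
  tropPGL_mul (tropPGL_class A) (tropPGL_class B) = tropPGL_class (A * B)%g.
Proof.
have /tropPGL_classP[c Ac] : tropPGL_class (repr (tropPGL_class A)) = tropPGL_class A.
  exact: reprK.
have /tropPGL_classP[d Bd] : tropPGL_class (repr (tropPGL_class B)) = tropPGL_class B.
  exact: reprK.
apply/tropPGL_classP; exists (c + d).
change (val A *m val B = (Some (c + d) : T) *:
  (val (repr (tropPGL_class A)) *m val (repr (tropPGL_class B)))).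
by rewrite Ac Bd -scalemxAl -scalemxAr scalerA.
Qed.

Lemma tropPGL_repr (g : tropPGL) : tropPGL_class (repr g) = g.
Proof. exact: reprK. Qed.

Fact tropPGL_mulA : associative tropPGL_mul.
Proof.
move=> g h k.
rewrite -(tropPGL_repr g) -(tropPGL_repr h) -(tropPGL_repr k).
by rewrite !tropPGL_mulE mulgA.
Qed.

Fact tropPGL_mul1g : left_id tropPGL_one tropPGL_mul.
Proof. by move=> g; rewrite -(tropPGL_repr g) tropPGL_mulE mul1g. Qed.

Fact tropPGL_mulg1 : right_id tropPGL_one tropPGL_mul.
Proof. by move=> g; rewrite -(tropPGL_repr g) tropPGL_mulE mulg1. Qed.

Fact tropPGL_mulVg : left_inverse tropPGL_one tropPGL_inv tropPGL_mul.
Proof.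
by move=> g; rewrite -{2}(tropPGL_repr g) tropPGL_mulE mulVg.
Qed.

Fact tropPGL_mulgV : right_inverse tropPGL_one tropPGL_inv tropPGL_mul.
Proof.
by move=> g; rewrite -{1}(tropPGL_repr g) tropPGL_mulE mulgV.
Qed.

HB.instance Definition _ := isGroup.Build tropPGL
  tropPGL_mulA tropPGL_mul1g tropPGL_mulg1 tropPGL_mulVg tropPGL_mulgV.

Fact trop_perm_invertible (s : 'S_n) : (perm_mx s : 'M[T]_n) \in trop_invertible.
Proof.
apply/asboolP; exists (perm_mx s^-1).
by split; rewrite -perm_mxM ?mulgV ?mulVg perm_mx1.
Qed.

(* The class of the map sending x to the vector with entries x (s i). *)
Definition tropPGL_perm (s : 'S_n) : tropPGL :=
  tropPGL_class (TropGL (trop_perm_invertible s)).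

End TropPGL.

Section Action.
Variable R : realType.
Local Notation T := (trop R).

Definition trop_homog (P : R * R) : 'cV[T]_3 :=
  \col_i (Some (tnth [tuple 0; P.1; P.2] i) : T).

(* An invertible matrix maps finite vectors to finite vectors, so the default
   value given to the entry -oo plays no role in the action. *)
Definition trop_fin (x : T) : R := odflt 0 x.

Definition trop_inhomog (v : 'cV[T]_3) : R * R :=
  let x i := trop_fin (v (inord i) 0) in (x 1%N - x 0%N, x 2%N - x 0%N).

Definition trop_act (g : tropPGL R 3) (P : R * R) : R * R :=
  trop_inhomog (val (repr g) *m trop_homog P).

Lemma trop_sum_eq0 n (F : 'I_n -> T) j : \sum_i F i = 0 -> F j = 0.
Proof. by rewrite (bigD1 j) //=; case: (F j) => [a|//]; case: (\sum_(_ < _ | _) _). Qed.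

Lemma trop_mul_homog_neq0 (A : tropGL R 3) P i : (val A *m trop_homog P) i 0 != 0.
Proof.
apply/eqP => Ai0; case: (tropGL_inv_mxP A) => /matrixP/(_ i i) + _.
rewrite !mxE eqxx big1 // => j _.
have : val A i j * trop_homog P j 0 = 0.
  by move: Ai0; rewrite mxE => /trop_sum_eq0.
by rewrite mxE; case: (val A i j).
Qed.

Lemma trop_act_class (A : tropGL R 3) P :
  trop_act (tropPGL_class A) P = trop_inhomog (val A *m trop_homog P).
Proof.
have /tropPGL_classP[c ->] : tropPGL_class (repr (tropPGL_class A)) = tropPGL_class A.
  exact: tropPGL_repr.
set B := repr _; have H i : trop_fin (((Some c : T) *: val B *m trop_homog P) i 0)
  = c + trop_fin ((val B *m trop_homog P) i 0).
  rewrite -scalemxAl mxE; have := trop_mul_homog_neq0 B P i.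
  by case: ((_ *m _) i 0).
rewrite /trop_act /trop_inhomog -/B !H.
by congr (_, _); rewrite opprD addrACA subrr add0r.
Qed.

Definition g0 : tropPGL R 3 := tropPGL_perm R (tperm (inord 1) (inord 2)).
Definition g1 : tropPGL R 3 := tropPGL_perm R (perm (@ordS_inj 3)).

End Action.

Section Groups.

Definition subgroup_generated (G : groupType) (S : set G) : set G :=
  smallest (fun H : set G => group_closed [in H]) S.

Definition isog_onto (G H : groupType) (A : set H) : Prop :=
  exists f : G -> H, [/\ {morph f : x y / (x * y)%g}, injective f & range f = A].

End Groups.

Section SemiDirect.

Definition SL2F3 : {set {'GL_2['F_3]}} := [set u | \det (GLval u) == 1]%SET.

Fact scal2_unit : (2%:M : 'M['F_3]_2) \is a GRing.unit.
Proof. by rewrite unitmxE det_scalar unitrX. Qed.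

Definition scal2 : {'GL_2['F_3]} := FinRing.unit 'M['F_3]_2 scal2_unit.

(* A matrix m acts on Z/3Z through the first coordinate of m (c, 0). *)
Definition Z3_act (m : {'GL_2['F_3]}) (c : 'F_3) : 'F_3 :=
  (GLval m *m \col_i (if i == 0 then c else 0)) 0 0.

Record Z3_sdprod := Z3Sdprod { Z3_part : 'F_3; lin_part : subg_of <[scal2]>%G }.

Definition Z3_sdprod_pair u := (Z3_part u, lin_part u).
Fact Z3_sdprod_pairK : cancel Z3_sdprod_pair (fun p => Z3Sdprod p.1 p.2).
Proof. by case. Qed.
HB.instance Definition _ := Choice.copy Z3_sdprod (can_type Z3_sdprod_pairK).

Definition Z3_sdprod_mul (u v : Z3_sdprod) :=
  Z3Sdprod (Z3_part u + Z3_act (sgval (lin_part u)) (Z3_part v))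
           (lin_part u * lin_part v)%g.
Definition Z3_sdprod_one := Z3Sdprod 0 1%g.
Definition Z3_sdprod_inv (u : Z3_sdprod) :=
  Z3Sdprod (- Z3_act (sgval (lin_part u)^-1)%g (Z3_part u)) (lin_part u)^-1%g.

Fact GLvalM (u v : {'GL_2['F_3]}) : GLval (u * v)%g = GLval u *m GLval v.
Proof. by []. Qed.

Fact scal2_cycle_scalar (m : subg_of <[scal2]>%G) :
  exists a, GLval (sgval m) = a%:M.
Proof.
case/cycleP: (subgP m) => k ->; elim: k => [|k [a IH]]; first by exists 1.
exists (2 * a); rewrite expgS; apply: etrans (GLvalM _ _) _.
by rewrite scalar_mxM; congr (_ *m _).
Qed.

Fact Z3_act1 c : Z3_act 1%g c = c.
Proof. by rewrite /Z3_act [GLval _]/= mul1mx mxE. Qed.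

Fact Z3_actD m c d : Z3_act m (c + d) = Z3_act m c + Z3_act m d.
Proof.
rewrite /Z3_act !mxE -big_split /=; apply: eq_bigr => i _.
by rewrite !mxE -mulrDr; case: eqP => // _; rewrite addr0.
Qed.

Fact Z3_actM (m1 m2 : subg_of <[scal2]>%G) c :
  Z3_act (sgval (m1 * m2)%g) c = Z3_act (sgval m1) (Z3_act (sgval m2) c).
Proof.
rewrite /Z3_act [GLval (sgval (_ * _)%g)]GLvalM.
have [a1 ->] := scal2_cycle_scalar m1; have [a2 ->] := scal2_cycle_scalar m2.
by rewrite -scalar_mxM !mul_scalar_mx !mxE /= mulrA.
Qed.

Fact Z3_sdprod_mulA : associative Z3_sdprod_mul.
Proof.
move=> [c m] [c' m'] [c'' m'']; rewrite /Z3_sdprod_mul /= mulgA; congr Z3Sdprod.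
by rewrite Z3_actM Z3_actD addrA.
Qed.

Fact Z3_sdprod_mul1g : left_id Z3_sdprod_one Z3_sdprod_mul.
Proof. by case=> c m; rewrite /Z3_sdprod_mul /= Z3_act1 add0r mul1g. Qed.

Fact Z3_act0 m : Z3_act m 0 = 0.
Proof. by apply: (addrI (Z3_act m 0)); rewrite -Z3_actD !addr0. Qed.

Fact Z3_sdprod_mulg1 : right_id Z3_sdprod_one Z3_sdprod_mul.
Proof. by case=> c m; rewrite /Z3_sdprod_mul /= Z3_act0 addr0 mulg1. Qed.

Fact Z3_sdprod_mulVg : left_inverse Z3_sdprod_one Z3_sdprod_inv Z3_sdprod_mul.
Proof. by case=> c m; rewrite /Z3_sdprod_mul /= addNr mulVg. Qed.

Fact Z3_sdprod_mulgV : right_inverse Z3_sdprod_one Z3_sdprod_inv Z3_sdprod_mul.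
Proof.
case=> c m; rewrite /Z3_sdprod_mul /= mulgV; congr Z3Sdprod.
have e : Z3_act (sgval (m * m^-1)%g) c = c by rewrite mulgV Z3_act1.
by rewrite -{1}e Z3_actM -Z3_actD subrr Z3_act0.
Qed.

HB.instance Definition _ := isGroup.Build Z3_sdprod
  Z3_sdprod_mulA Z3_sdprod_mul1g Z3_sdprod_mulg1
  Z3_sdprod_mulVg Z3_sdprod_mulgV.

End SemiDirect.

Section HessePencil.
Variable R : realType.
Implicit Types (k : R) (P Q A u : R * R).

Definition hesse_F k P : R :=
  Num.max (Num.max (3 * P.1) (3 * P.2)) (Num.max 0 (k + P.1 + P.2)).

Definition hesse_curve k : set (R * R) :=
  [set P | ~ differentiable (hesse_F k) P].

Definition pencil_aut : set (tropPGL R 3) :=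
  [set g | forall k, exists k', trop_act g @` hesse_curve k = hesse_curve k'].

(* The unbounded edges without their end vertices: on a plane curve made of
   segments and half-lines, these are the points lying on a half-line contained
   in the curve and distinct from its origin. *)
Definition unbounded_edges k : set (R * R) :=
  [set P | exists A u, [/\ u != 0,
    (forall t, 0 <= t -> hesse_curve k (A + t *: u)) &
    exists2 t, 0 < t & P = A + t *: u]].

Definition hesse_cycle k : set (R * R) := hesse_curve k `\` unbounded_edges k.

Definition V1 k : R * R := (k, k).
Definition V3 k : R * R := (0, - k).

Definition period_lattice k : {pred R} :=
  fun x => `[< exists n : int, x = n%:~R * (3 * k) >].

Fact period_lattice_zmod k : zmod_closed (period_lattice k).
Proof.
split=> [|x y /asboolP[m ->] /asboolP[n ->]]; apply/asboolP.
  by exists 0; rewrite mul0r.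
by exists (m - n); rewrite intrB mulrBl.
Qed.

HB.instance Definition _ k :=
  GRing.isZmodClosed.Build R (period_lattice k) (period_lattice_zmod k).

Definition jac_group k : zmodType := Quotient.quot (period_lattice k).

Definition jac_class k (t : R) : jac_group k := \pi_(jac_group k) t.

(* For 0 <= t <= 3 * k; the three branches run along the three sides of the
   triangle. *)
Definition jac_param k (t : R) : R * R :=
  if t <= k then (k - 2 * t, k - t)
  else if t <= 2 * k then (- k + (t - k), - (t - k))
  else (t - 2 * k, - k + 2 * (t - 2 * k)).

(* The representative of j in [0, 3k[ is used; it exists for k > 0. *)
Definition jac_phi k (j : jac_group k) : R * R :=
  jac_param k (xget 0 [set t | 0 <= t < 3 * k /\ jac_class k t = j]).

Definition jac_phi_inv k P : jac_group k := xget 0 [set j | jac_phi j = P].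

Definition cycle_add k P Q : R * R :=
  jac_phi (jac_phi_inv k P + jac_phi_inv k Q).

Lemma jac_classP k s t : jac_class k s = jac_class k t <->
  exists n : int, s - t = n%:~R * (3 * k).
Proof.
split; first by move/eqP; rewrite -[_ == _]Quotient.idealrBE => /asboolP.
by move=> H; apply/eqP; rewrite -[_ == _]Quotient.idealrBE; apply/asboolP.
Qed.

Lemma jac_class_inj k s t : 0 <= s < 3 * k -> 0 <= t < 3 * k ->
  jac_class k s = jac_class k t -> s = t.
Proof.
move=> /andP[s0 s1] /andP[t0 t1] /jac_classP[n E].
have k0 : 0 < 3 * k by lra.
have : `|n%:~R * (3 * k)| < 3 * k by rewrite -E ltr_norml; lra.
rewrite normrM (gtr0_norm k0) -[ltRHS]mul1r (ltr_pM2r k0) -intr_norm ltrz1.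
move=> H; have n0 : n = 0 by lia.
by move: E; rewrite n0 mul0r; lra.
Qed.

Lemma xget_rep k t : 0 <= t < 3 * k ->
  xget 0 [set s | 0 <= s < 3 * k /\ jac_class k s = jac_class k t] = t.
Proof.
by move=> t0; apply: xget_unique => // y [y0 /jac_class_inj]; apply.
Qed.

Lemma jac_phi_class k t : 0 < k -> 0 <= t <= 3 * k ->
  jac_phi (jac_class k t) = jac_param k t.
Proof.
move=> k0 /andP[t0]; rewrite le_eqVlt => /orP[/eqP->|t1]; last first.
  by rewrite /jac_phi xget_rep ?t0.
have -> : jac_class k (3 * k) = jac_class k 0.
  by apply/jac_classP; exists 1; rewrite mul1r subr0.
rewrite /jac_phi xget_rep; last lra.
rewrite /jac_param (ltW k0) !ifN -?ltNge; [|lra..].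
by congr (_, _); lra.
Qed.

Lemma jac_class_rep k (j : jac_group k) : 0 < k ->
  exists2 t, 0 <= t < 3 * k & jac_class k t = j.
Proof.
move=> k0; have k3 : 0 < 3 * k by lra.
pose n := Num.floor (repr j / (3 * k)).
exists (repr j - n%:~R * (3 * k)).
  have /andP[] := floor_itv (repr j / (3 * k)).
  by rewrite ler_pdivlMr // ltr_pdivrMr // -/n rmorphD /=; lra.
rewrite -[RHS]reprK; apply/jac_classP; exists (- n).
by rewrite mulrNz mulNr; lra.
Qed.

Lemma jac_phi_inj k : 0 < k -> injective (@jac_phi k).
Proof.
move=> k0 i j.
have [s s0 <-] := jac_class_rep i k0; have [t t0 <-] := jac_class_rep j k0.
rewrite !jac_phi_class //; [|lra|lra].
rewrite /jac_param => E; congr jac_class; move: E.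
by case: (leP s k) => ?; case: (leP t k) => ?; try case: (leP s (2 * k)) => ?;
  try case: (leP t (2 * k)) => ?; case=> ? ?; lra.
Qed.

Lemma cycle_addE k (i j : jac_group k) : 0 < k ->
  cycle_add k (jac_phi i) (jac_phi j) = jac_phi (i + j).
Proof.
move=> k0; have H (l : jac_group k) : jac_phi_inv k (jac_phi l) = l.
  by apply: xget_unique => // y; apply: jac_phi_inj.
by rewrite /cycle_add !H.
Qed.
Definition dotp A u : R := A.1 * u.1 + A.2 * u.2.

(* For a line L and each P there is exactly one such Q: the midpoint of P and Q
   lies on L and Q - P is orthogonal to L. *)
Definition reflected (L : set (R * R)) P Q : Prop :=
  L ((2^-1 : R) *: (P + Q)) /\
  forall A B, L A -> L B -> dotp (Q - P) (B - A) = 0.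

Definition line_XY : set (R * R) := [set P | P.2 = P.1].

End HessePencil.

Arguments pencil_aut R : clear implicits.
Arguments line_XY R : clear implicits.
Arguments jac_class {R} k t.

(* Main.v *)
(** A max of affine functions is differentiable exactly where a single term is
    maximal: there it is locally affine, whereas each maximal term is a
    supporting plane and so determines the differential. Hence every curve of
    the pencil is given by explicit inequalities.

    An invertible matrix over the max-plus semifield is monomial, so an element
    of PGL(3,T) acts as a permutation of the homogeneous coordinates followed
    by a translation by some v. Permutations preserve every curve. If
    [C_0 + v = C_k], then the linear map [r] of g1 preserves [C_0 + v], so
    [r v - v] and its opposite both lie on the tripod [C_0]; this forces
    [r v = v] and then [v = 0]. The automorphism group is therefore the
    symmetric group of degree three. *)
Require Import Defs.
From mathcomp Require Import all_boot all_order all_algebra all_fingroup.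
From mathcomp Require Import all_solvable.
From mathcomp Require Import all_classical all_reals all_analysis.
From mathcomp Require Import ring lra.
From mathcomp Require Import generic_quotient ring_quotient.
Import numFieldNormedType.Exports.
Set Implicit Arguments.
Unset Strict Implicit.
Unset Printing Implicit Defensive.

Import Order.TTheory GRing.Theory Num.Theory.
Local Open Scope quotient_scope.
Local Open Scope classical_set_scope.
Local Open Scope ring_scope.

(** * Differentiability, supporting lines and affine functions *)

Lemma near_eq_differentiable (R : realType) (V W : normedModType R)
  (f g : V -> W) (a : V) :
  {near a, f =1 g} -> differentiable g a -> differentiable f a.
Proof.
move=> fg dg; have fga : f a = g a by exact: nbhs_singleton fg.
have [dgc gE] := (diff_locallyP a g).1 dg.
(* The first-order expansion of [g] at [a] also serves [f]; uniqueness of the differential then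
   makes it that of [f]. *)
have fE : f \o shift a = cst (f a) + 'd g a +o_ 0 id.
  move: gE => /eqaddoP gE; apply/eqaddoP => e e0.
  have := gE e e0; apply: filter_app.
  have : \forall h \near 0, f (h + a) = g (h + a).
    move: fg; rewrite (near_shift 0 a) => fg0.
    by apply: filterS fg0 => h; rewrite /= subr0.
  by apply: filter_app; near=> h => fgh; rewrite !fctE /= fga fgh.
have dfE := diff_unique dgc fE.
by apply/diff_locallyP; split; rewrite dfE.
Unshelve. all: by end_near. Qed.

(** The difference quotient is at most [s] for negative increments and at least [s] for positive
    ones, so the two one-sided limits squeeze the derivative. *)
Lemma derive_supporting_line (R : realType) (V : normedModType R) (f : V -> R)
    (a v : V) (s : R) :
  derivable f a v -> (forall t : R, f a + s * t <= f (t *: v + a)) ->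
  'D_v f a = s.
Proof.
move=> df fs; apply/eqP; rewrite eq_le; apply/andP; split.
  have dl := cvg_dnbhs_at_left df.
  rewrite /derive -(cvg_lim _ dl) //; apply: limr_le.
    by apply/cvg_ex; eexists; exact: dl.
  near=> t; have t0 : t < 0 by near: t; exact: nbhs_left_lt.
  rewrite /= [_^-1 *: _]mulrC ler_ndivrMr //.
  by have := fs t; rewrite /shift /=; lra.
have dr := cvg_dnbhs_at_right df.
rewrite /derive -(cvg_lim _ dr) //; apply: limr_ge.
  by apply/cvg_ex; eexists; exact: dr.
near=> t; have t0 : 0 < t by near: t; exact: nbhs_right_gt.
rewrite /= [_^-1 *: _]mulrC ler_pdivlMr //.
by have := fs t; rewrite /shift /=; lra.
Unshelve. all: by end_near. Qed.

Definition affine_fun (R : realType) (a b c : R) (P : R * R) : R :=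
  a * P.1 + b * P.2 + c.

Lemma affine_fun_differentiable (R : realType) (a b c : R) (P : R * R) :
  differentiable (affine_fun a b c) P.
Proof.
rewrite /affine_fun; apply: differentiableD => //; apply: differentiableD.
  apply: differentiableM => //.
  by apply: linear_differentiable => x; exact: cvg_fst.
apply: differentiableM => //.
by apply: linear_differentiable => x; exact: cvg_snd.
Qed.

Lemma near_affine_lt (R : realType) (a b c a' b' c' : R) (P : R * R) :
  affine_fun a b c P < affine_fun a' b' c' P ->
  \forall Q \near P, affine_fun a b c Q < affine_fun a' b' c' Q.
Proof.
move=> lt0.
have dD := differentiable_continuous
  (affine_fun_differentiable (a' - a) (b' - b) (c' - c) P).
have {dD} := cvgr_gt _ dD 0 _.
have -> : affine_fun (a' - a) (b' - b) (c' - c) P =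
          affine_fun a' b' c' P - affine_fun a b c P.
  by rewrite /affine_fun; ring.
rewrite subr_gt0 => /(_ _ lt0); apply: filterS => Q.
by rewrite /affine_fun; lra.
Qed.

Ltac attained_twice :=
  first [ left; constructor 1; split; lra | left; constructor 2; split; lra
        | left; constructor 3; split; lra | right; constructor 1; split; lra
        | right; constructor 2; split; lra | right; constructor 3; split; lra ].

(** Handles one competing term: either it is the chosen term itself, or it is strictly smaller
    because a tie would be a case of [max_attained_twice]. *)
Ltac dominated strict :=
  first [ by right
        | left; rewrite /affine_fun; apply: strict => [|e]; [lra|attained_twice] ].

(** * The curves of the pencil as sets of explicit inequalities *)

Section HesseCurve.
Context {R : realType}.
Implicit Types (k : R) (P Q : R * R).

Lemma hesse_F_le k P v : (hesse_F k P <= v) =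
  [&& 3 * P.1 <= v, 3 * P.2 <= v, 0 <= v & k + P.1 + P.2 <= v].
Proof. by rewrite /hesse_F !ge_max -andbA. Qed.

Lemma hesse_F_ge k : [/\ forall P, affine_fun 3 0 0 P <= hesse_F k P,
  forall P, affine_fun 0 3 0 P <= hesse_F k P,
  forall P, affine_fun 0 0 0 P <= hesse_F k P
  & forall P, affine_fun 1 1 k P <= hesse_F k P].
Proof.
have ge P := lexx (hesse_F k P).
by split=> P; move: (ge P); rewrite {1}hesse_F_le /affine_fun => /and4P[]; lra.
Qed.

Lemma hesse_F_derive k P a b c : differentiable (hesse_F k) P ->
  (forall Q, affine_fun a b c Q <= hesse_F k Q) ->
  hesse_F k P <= affine_fun a b c P ->
  'D_(1, 0) (hesse_F k) P = a /\ 'D_(0, 1) (hesse_F k) P = b.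
Proof.
move=> dF Fge FP; split; apply: derive_supporting_line;
  try exact: diff_derivable; move=> h.
  have := Fge (h *: (1, 0) + P); move: FP.
  by rewrite /affine_fun /= /GRing.scale /=; lra.
have := Fge (h *: (0, 1) + P); move: FP.
by rewrite /affine_fun /= /GRing.scale /=; lra.
Qed.

(** Two supporting planes touching at [P] would give the partial derivatives two different pairs of
    values. *)
Lemma hesse_curveI k P a b c a' b' c' : (a, b) <> (a', b') ->
  (forall Q, affine_fun a b c Q <= hesse_F k Q) ->
  (forall Q, affine_fun a' b' c' Q <= hesse_F k Q) ->
  hesse_F k P <= affine_fun a b c P -> hesse_F k P <= affine_fun a' b' c' P ->
  hesse_curve k P.
Proof.
move=> ab Fge Fge' FP FP' dF; apply: ab.
have [<- <-] := hesse_F_derive dF Fge FP.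
by have [<- <-] := hesse_F_derive dF Fge' FP'.
Qed.

(* One case per pair of equal maximal terms among 3X, 3Y, 0 and k + X + Y: for
   0 < k, the first three are the half-lines and the last three the sides. *)
Definition max_attained_twice k P : Prop :=
  [\/ [/\ P.1 = P.2, 0 <= P.1 & k <= P.1],
      [/\ P.1 = 0, P.2 <= 0 & k + P.2 <= 0]
    | [/\ P.2 = 0, P.1 <= 0 & k + P.1 <= 0]] \/
  [\/ [/\ k + P.2 = 2 * P.1, 0 <= P.1 & P.2 <= P.1],
      [/\ k + P.1 = 2 * P.2, 0 <= P.2 & P.1 <= P.2]
    | [/\ k + P.1 + P.2 = 0, P.1 <= 0 & P.2 <= 0]].

Lemma max_attained_twice_curve k P : max_attained_twice k P -> hesse_curve k P.
Proof.
have [p1 p2 p3 p4] := hesse_F_ge k.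
case=> -[] [h1 h2 h3];
  [ apply: (@hesse_curveI k P 3 0 0 0 3 0) | apply: (@hesse_curveI k P 3 0 0 0 0 0)
  | apply: (@hesse_curveI k P 0 3 0 0 0 0) | apply: (@hesse_curveI k P 3 0 0 1 1 k)
  | apply: (@hesse_curveI k P 0 3 0 1 1 k) | apply: (@hesse_curveI k P 0 0 0 1 1 k) ];
  rewrite // ?[hesse_F k P <= _]hesse_F_le; try (by case; lra);
  by rewrite /affine_fun; apply/and4P; split; lra.
Qed.

Lemma near_affine_differentiable k P a b c :
  (\forall Q \near P, hesse_F k Q <= affine_fun a b c Q) ->
  (forall Q, affine_fun a b c Q <= hesse_F k Q) ->
  differentiable (hesse_F k) P.
Proof.
move=> Fle Fge; apply: near_eq_differentiable (affine_fun_differentiable a b c P).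
by apply: filterS Fle => Q FQ; apply/eqP; rewrite eq_le FQ Fge.
Qed.

Lemma hesse_curveP k P : hesse_curve k P <-> max_attained_twice k P.
Proof.
split; last exact: max_attained_twice_curve.
move=> ndF; apply: contrapT => nP; apply: ndF.
(* A term that strictly beats the other three at [P] still does so nearby by continuity, and there
   [hesse_F] coincides with it. *)
have dominant a b c :
    (forall Q, affine_fun a b c Q <= hesse_F k Q) ->
    [/\ affine_fun 3 0 0 P < affine_fun a b c P \/ (a, b, c) = (3, 0, 0),
        affine_fun 0 3 0 P < affine_fun a b c P \/ (a, b, c) = (0, 3, 0),
        affine_fun 0 0 0 P < affine_fun a b c P \/ (a, b, c) = (0, 0, 0)
      & affine_fun 1 1 k P < affine_fun a b c P \/ (a, b, c) = (1, 1, k)] ->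
    differentiable (hesse_F k) P.
  have near_le a' b' c' : affine_fun a' b' c' P < affine_fun a b c P \/
      (a, b, c) = (a', b', c') ->
      \forall Q \near P, affine_fun a' b' c' Q <= affine_fun a b c Q.
    case=> [/near_affine_lt|[-> -> ->]]; first by apply: filterS => Q /ltW.
    by apply: filterE => Q; exact: lexx.
  move=> Fge [/near_le n1 /near_le n2 /near_le n3 /near_le n4].
  apply: near_affine_differentiable Fge; near=> Q.
  have l1 : affine_fun 3 0 0 Q <= affine_fun a b c Q by near: Q.
  have l2 : affine_fun 0 3 0 Q <= affine_fun a b c Q by near: Q.
  have l3 : affine_fun 0 0 0 Q <= affine_fun a b c Q by near: Q.
  have l4 : affine_fun 1 1 k Q <= affine_fun a b c Q by near: Q.
  rewrite hesse_F_le; apply/and4P; move: l1 l2 l3 l4; rewrite /affine_fun.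
  by split; lra.
have strict (u v : R) : u <= v -> (u = v -> max_attained_twice k P) -> u < v.
  by move=> uv uvP; rewrite lt_neqAle uv andbT; apply/eqP => /uvP.
have [p1 p2 p3 p4] := hesse_F_ge k.
(* A knockout among the four terms: two pairs are compared, then their winners, so each of the eight
   branches has a known maximal term for [dominant]. *)
have [h1|h1] := leP (3 * P.1) (3 * P.2);
  have [h2|h2] := leP 0 (k + P.1 + P.2);
  [ have [h3|h3] := leP (3 * P.2) (k + P.1 + P.2)
  | have [h3|h3] := leP (3 * P.2) 0
  | have [h3|h3] := leP (3 * P.1) (k + P.1 + P.2)
  | have [h3|h3] := leP (3 * P.1) 0 ];
  first [ apply: (dominant 3 0 0) => //; solve [split; dominated strict]
        | apply: (dominant 0 3 0) => //; solve [split; dominated strict]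
        | apply: (dominant 0 0 0) => //; solve [split; dominated strict]
        | apply: (dominant 1 1 k) => //; solve [split; dominated strict] ].
Unshelve. all: by end_near. Qed.
End HesseCurve.

(** * The symmetric group of degree three, its generators and relations *)

Local Notation tau := (tperm (inord 1) (inord 2) : 'S_3).
Local Notation rho := (perm (@ordS_inj 3) : 'S_3).

Section SymmetricGroup3.

Lemma swap_sq : (tau ^+ 2 = 1)%g.
Proof. by rewrite expgS expg1 tperm2. Qed.

Lemma ord3_forall (P : 'I_3 -> Prop) :
  P (inord 0) -> P (inord 1) -> P (inord 2) -> forall i, P i.
Proof.
move=> P0 P1 P2 i; rewrite -(inord_val i).
by case: (nat_of_ord i) (ltn_ord i) => [|[|[|]]].
Qed.

Lemma rotE j : (j < 3)%N -> rho (inord j) = inord (j.+1 %% 3).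
Proof. by move=> j3; apply: val_inj; rewrite permE /= !inordK// ltn_mod. Qed.

Lemma swapE : [/\ tau (inord 0) = inord 0, tau (inord 1) = inord 2
  & tau (inord 2) = inord 1].
Proof.
by rewrite tpermL tpermR tpermD // -val_eqE /= !inordK.
Qed.

Lemma rot_cube : (rho ^+ 3 = 1)%g.
Proof.
by apply/permP; apply: ord3_forall; rewrite 2!expgS expg1 !permM !rotE ?perm1.
Qed.

Lemma swap_rot_sq : ((tau * rho) ^+ 2 = 1)%g.
Proof.
have [t0 t1 t2] := swapE.
by apply/permP; apply: ord3_forall;
  rewrite expgS expg1 !permM ?(t0, t1, t2, rotE) ?perm1.
Qed.

Lemma neq_inord i j : (i < 3)%N -> (j < 3)%N -> i != j -> inord i != inord j :> 'I_3.
Proof. by move=> i3 j3; rewrite -val_eqE /= !inordK. Qed.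

Lemma swap_neq1 : tau != 1%g.
Proof.
have [_ t1 _] := swapE.
by apply: contraNneq (@neq_inord 2 1 isT isT isT) => e; rewrite -t1 e perm1 eqxx.
Qed.

Lemma rot_order : #[rho]%g = 3%N.
Proof.
apply: nt_prime_order => //; first exact: rot_cube.
apply: contraNneq (@neq_inord 1 0 isT isT isT) => e.
by rewrite -[inord 1](@rotE 0) // e perm1 eqxx.
Qed.

Lemma gen_swap_rot : <<[set tau; rho]%SET>>%g = [set: 'S_3]%SET.
Proof.
rewrite gen_tperm_circular_shift ?card_ord ?rot_order //.
exact: (@neq_inord 1 2).
Qed.

Lemma swap_rot_neq_swap : (tau * rho)%g != tau.
Proof.
rewrite -[X in _ != X]mulg1 (inj_eq (mulgI tau)).
by rewrite -order_gt1 rot_order.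
Qed.

(** The distinct involutions [tau] and [tau * rho] generate ['S_3], and a group generated by two
    distinct involutions is dihedral. *)
Lemma S3_isog_dihedral : [set: 'S_3]%G \isog [set: dihedral_gtype 6]%G.
Proof.
have := @involutions_gen_dihedral _ tau (tau * rho)%g.
have -> : <<[set tau; (tau * rho)%g]%SET>>%g = [set: 'S_3]%SET.
  apply/eqP; rewrite -finset.subTset -gen_swap_rot gen_subG.
  apply/fintype.subsetP => x; rewrite finset.in_set2 => /orP[]/eqP->.
    by rewrite mem_gen ?set21.
  by rewrite -[X in X \in _](mulKg tau rho) groupM ?groupV ?mem_gen ?set21 ?set22.
rewrite /= finset.cardsT card_Sn; apply; last by rewrite eq_sym swap_rot_neq_swap.
- exact: nt_prime_order swap_sq swap_neq1.
- apply: nt_prime_order swap_rot_sq _ => //.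
  (* If [tau * rho] were trivial, [rho] would have the order of [tau], which is 2 and not 3. *)
  apply/eqP => e; have := rot_order; have : rho = tau^-1%g.
    by rewrite -[rho](mulKg tau) e mulg1.
  move=> ->; by rewrite orderV (nt_prime_order _ swap_sq swap_neq1).
Qed.

(** The relation [(tau * rho) ^+ 2 = 1] says that conjugation by the involution [tau] inverts [rho],
    hence also its powers. *)
Lemma rot_swap n : (rho ^+ n * tau = tau * rho ^- n)%g.
Proof.
have tt : (tau * tau = 1)%g by rewrite -expg2 swap_sq.
have tV : (tau^-1 = tau)%g by apply/eqP; rewrite eq_invg_mul tt.
have e : (rho ^ tau = rho^-1)%g.
  apply: (mulgI rho); rewrite mulgV /conjg tV; apply: (mulgI tau).
  have := congr1 (mulg^~ tau) swap_rot_sq.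
  by rewrite expg2 mul1g mulg1 -!mulgA.
by rewrite conjgC conjXg e expVgn.
Qed.

Lemma swap_rot n : (tau * rho ^+ n = rho ^- n * tau)%g.
Proof. by apply: (mulgI (rho ^+ n)%g); rewrite mulgA rot_swap mulKVg mulgKV. Qed.

(** In a finite group, closure under products makes the elements satisfying [P] a subgroup, and this
    one contains both generators. *)
Lemma S3_ind (P : 'S_3 -> Prop) :
  P 1%g -> (forall s t, P s -> P t -> P (s * t)%g) -> P tau -> P rho ->
  forall s, P s.
Proof.
move=> P1 PM Ptau Prho s.
have gK : group_set [set t | `[< P t >]]%SET.
  apply/group_setP; split=> [|x y]; first by rewrite finset.in_set; apply/asboolP.
  by rewrite !finset.in_set => /asboolP ? /asboolP ?; apply/asboolP/PM.
have : s \in [set: 'S_3]%SET by rewrite finset.in_setT.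
rewrite -gen_swap_rot => sg.
suff : s \in Group gK by rewrite finset.in_set => /asboolP.
move: s sg; apply/fintype.subsetP; rewrite gen_subG.
apply/fintype.subsetP => s; rewrite finset.in_set2 finset.in_set.
by move=> /orP[]/eqP->; apply/asboolP.
Qed.

End SymmetricGroup3.

(** * The subgroup of order two of SL(2,F_3) *)

Lemma scal2_neq1 : scal2 != 1%g.
Proof. by apply/eqP => /(congr1 val)/matrixP/(_ 0 0); rewrite !mxE. Qed.

Lemma scal2_sq : (scal2 ^+ 2 = 1)%g.
Proof.
apply: val_inj; rewrite expg2 /= -[LHS]/(2%:M *m 2%:M) -scalar_mxM.
by congr _%:M; apply/eqP.
Qed.

Lemma scal2_order : #[scal2]%g = 2%N.
Proof. by apply: nt_prime_order scal2_sq scal2_neq1. Qed.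

Lemma scal2_SL2F3 : scal2 \in SL2F3.
Proof. by rewrite inE /= det_scalar; apply/eqP/eqP. Qed.

Lemma scal2_cycle (m : subg_of <[scal2]>%G) : m = 1%g \/ sgval m = scal2.
Proof.
case: (cyclePmin (subgP m)) => n; rewrite scal2_order => n2 mE.
case: n n2 mE => [|[|//]] _ mE; [left; apply: val_inj|right] => //=.
Qed.

Lemma Z3_act_scal2 c : Z3_act scal2 c = - c.
Proof.
rewrite /Z3_act mul_scalar_mx !mxE /=.
have -> : (2 : 'F_3) = -1 by apply/eqP.
by rewrite mulN1r.
Qed.

(** * Invertible max-plus matrices are monomial; permutations inside PGL *)

Section TropicalMonomial.
Context {R : realType} {n : nat}.
Local Notation T := (trop R).
Implicit Types (s t : 'S_n) (a : 'I_n -> R).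

Definition monomial_mx s a : 'M[T]_n :=
  \matrix_(i, j) if j == s i then (Some (a i) : T) else 0.

Lemma trop_mul_eq0 (x y : T) : x * y = 0 -> x = 0 \/ y = 0.
Proof. by case: x y => [x|] [y|] //; [right|left|left]. Qed.

(** Max-plus sums do not cancel, so an off-diagonal -oo in [A *m B] or [B *m A] forces every product
    in that sum to be -oo. With a pivot chosen in each row of [A], the zeros of [A *m B] make the
    pivots distinct and those of [B *m A] clear the rest of the row. *)
Lemma trop_inverse_monomial (A B : 'M[T]_n) :
  trop_inverse A B -> exists s a, A = monomial_mx s a.
Proof.
move=> [AB BA].
have AB0 i k j : i != k -> A i j = 0 \/ B j k = 0.
  move=> ik; apply: trop_mul_eq0.
  have /matrixP/(_ i k) := AB; rewrite !mxE (negPf ik).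
  exact: (@trop_sum_eq0 _ _ (fun j => A i j * B j k)).
have BA0 i k j : i != k -> B i j = 0 \/ A j k = 0.
  move=> ik; apply: trop_mul_eq0.
  have /matrixP/(_ i k) := BA; rewrite !mxE (negPf ik).
  exact: (@trop_sum_eq0 _ _ (fun j => B i j * A j k)).
have pivot i : {j | A i j != 0 /\ B j i != 0}.
  apply: cid; apply: contrapT => noj; have /matrixP/(_ i i) := AB.
  rewrite !mxE eqxx big1 // => j _; case Aij: (A i j) => [x|//].
  case Bji: (B j i) => [y|//]; case: noj; exists j.
  by rewrite Aij Bji.
pose f i := sval (pivot i).
have fP i : A i (f i) != 0 /\ B (f i) i != 0 by rewrite /f; case: (pivot i).
have f_inj : injective f.
  move=> i k fik; apply/eqP; apply/negPn/negP => ik; have [e|e] := AB0 i k (f i) ik.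
    by have [] := fP i; rewrite e eqxx.
  by have [_] := fP k; rewrite -fik e eqxx.
(* Pivot entries are finite, so the default value of [trop_fin] is never reached. *)
exists (perm f_inj), (fun i => trop_fin (A i (f i))).
apply/matrixP => i j; rewrite !mxE permE; case: eqVneq => [->|jf].
  by have [] := fP i; case: (A i (f i)).
have [e|//] := BA0 (f i) j i (contra_neq esym jf).
by have [_] := fP i; rewrite e eqxx.
Qed.

Lemma monomial_mx_perm s : monomial_mx s (fun=> 0) = perm_mx s.
Proof. by apply/matrixP => i j; rewrite !mxE eq_sym; case: eqP. Qed.

Lemma tropPGL_permM : {morph @tropPGL_perm R n : s t / (s * t)%g}.
Proof.
move=> s t; rewrite [RHS]tropPGL_mulE; congr tropPGL_class.
by apply: val_inj; rewrite /= perm_mxM.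
Qed.

Lemma tropPGL_perm1 : tropPGL_perm R (1%g : 'S_n) = 1%g.
Proof. by apply: (mulgI (tropPGL_perm R 1%g)); rewrite -tropPGL_permM !mulg1. Qed.

Lemma tropPGL_permX s m : (tropPGL_perm R s ^+ m)%g = tropPGL_perm R (s ^+ m)%g.
Proof. by elim: m => [|m IH]; rewrite ?tropPGL_perm1 // !expgS IH tropPGL_permM. Qed.

(** Tropical scaling keeps the positions of the finite entries, and these determine the
    permutation. *)
Lemma tropPGL_perm_inj : injective (@tropPGL_perm R n).
Proof.
move=> s t /tropPGL_classP[c] /= tE; apply/permP => i.
have /matrixP/(_ i (s i)) := tE; rewrite !mxE eqxx.
by case: eqP => // -> .
Qed.

End TropicalMonomial.

(** * The generated subgroup and its dihedral and semi-direct models *)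

Lemma range_group_closed (G H : groupType) (f : G -> H) :
  {morph f : x y / (x * y)%g} -> group_closed [in range f].
Proof.
move=> fM; have f1 : f 1%g = 1%g by apply: (mulgI (f 1%g)); rewrite -fM !mulg1.
split; first by apply/mem_set; exists 1%g.
move=> _ _ /set_mem[x _ <-] /set_mem[y _ <-]; apply/mem_set.
exists (x * y^-1)%g => //; apply: (mulIg (f y)).
by rewrite -fM !mulgKV.
Qed.

Section Generated.
Context {R : realType}.

Lemma S3_generated (H : set (tropPGL R 3)) :
  group_closed [in H] -> H (g0 R) -> H (g1 R) -> forall s, H (tropPGL_perm R s).
Proof.
move=> Hgrp Hg0 Hg1; apply: S3_ind => // [|s t Hs Ht].
  by rewrite tropPGL_perm1; apply: set_mem Hgrp.1.
by rewrite tropPGL_permM; apply/set_mem/(group_closedM Hgrp); apply/mem_set.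
Qed.

Lemma subgroup_generated_S3 :
  subgroup_generated [set g0 R; g1 R] = range (@tropPGL_perm R 3).
Proof.
apply/seteqP; split.
  apply: smallest_sub; first exact: range_group_closed tropPGL_permM.
  move=> _ [->|->]; first by exists tau.
  by exists rho.
move=> _ [s _ <-] H [Hgrp Hg].
by apply: S3_generated => //; apply: Hg; [left|right].
Qed.

(** Shared by the two models: an embedding into ['S_3] that reaches both generators is onto. *)
Lemma subgroup_generated_isog (G : groupType) (phi : G -> 'S_3) :
  {morph phi : x y / (x * y)%g} -> injective phi ->
  (exists x, phi x = tau) -> (exists x, phi x = rho) ->
  isog_onto G (subgroup_generated [set g0 R; g1 R]).
Proof.
move=> phiM phi_inj [x0 phix0] [x1 phix1].
pose f x := tropPGL_perm R (phi x).
have fM : {morph f : x y / (x * y)%g}.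
  by move=> x y; rewrite /f phiM tropPGL_permM.
exists f; split=> // [x y /tropPGL_perm_inj/phi_inj //|].
rewrite subgroup_generated_S3; apply/seteqP; split.
  by move=> _ [x _ <-]; exists (phi x).
move=> _ [s _ <-]; apply: S3_generated.
- exact: range_group_closed.
- by exists x0; rewrite // /f phix0.
- by exists x1; rewrite // /f phix1.
Qed.

Lemma dihedral_isog_onto :
  isog_onto (dihedral_gtype 6) (subgroup_generated [set g0 R; g1 R]).
Proof.
have : [set: dihedral_gtype 6]%G \isog [set: 'S_3]%G by rewrite isog_sym S3_isog_dihedral.
case/isogP => h /injmP h_inj him.
have surj s : exists x, h x = s.
  have : s \in (h @* [set: dihedral_gtype 6]%SET)%g by rewrite him finset.in_setT.
  by case/morphimP => x _ _ ->; exists x.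
apply: (@subgroup_generated_isog _ h) => //.
- by move=> x y; rewrite morphM ?finset.in_setT.
- by move=> x y; apply: h_inj; rewrite finset.in_setT.
- exact: surj.
- exact: surj.
Qed.

(** The exponent on the left is a sum reduced modulo 3, which [rot_cube] absorbs. *)
Lemma rot_expF3D (c d : 'F_3) : (rho ^+ (c + d)%R = rho ^+ c * rho ^+ d)%g.
Proof. by rewrite -expgD -[RHS](expg_mod _ rot_cube). Qed.

Lemma rot_expF3N (c : 'F_3) : (rho ^+ (- c)%R = rho ^- c)%g.
Proof.
apply/eqP; rewrite eq_sym eq_invg_mul -rot_expF3D subrr.
by rewrite expg0.
Qed.

(** The normal form rotation times reflection; the boolean exponent is 1 exactly when the linear
    part is [scal2]. *)
Definition sdprod_perm (u : Z3_sdprod) : 'S_3 :=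
  (rho ^+ Z3_part u * tau ^+ (lin_part u != 1))%g.

(** [scal2] negates Z/3Z just as moving [tau] across a power of [rho] inverts that power. *)
Lemma sdprod_permM : {morph sdprod_perm : u v / (u * v)%g}.
Proof.
case=> [c m] [c' m']; rewrite /sdprod_perm /=.
rewrite rot_expF3D -!mulgA; congr (_ * _)%g.
have [->|mE] := scal2_cycle m.
  by rewrite Z3_act1 mul1g eqxx expg0 mul1g.
have m1 : m != 1%g.
  by apply: contraNneq scal2_neq1 => m1; rewrite -mE m1.
rewrite mE Z3_act_scal2 rot_expF3N m1 expg1 mulgA swap_rot -mulgA.
congr (_ * _)%g; have [->|mE'] := scal2_cycle m'.
  by rewrite mulg1 m1 eqxx expg0 mulg1.
have -> : m' != 1%g.
  by apply: contraNneq scal2_neq1 => m1'; rewrite -mE' m1'.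
have -> : (m * m')%g = 1%g.
  by apply: val_inj; rewrite /= mE mE' -expg2 scal2_sq.
by rewrite eqxx expg0 expg1 -expg2 swap_sq.
Qed.

Lemma sdprod_perm_inj : injective sdprod_perm.
Proof.
(* The sign of a permutation recovers the linear part. *)
have odd_rot : rho = false :> bool.
  have := congr1 (@odd_perm _) rot_cube; rewrite 2!expgS expg1 !odd_permM odd_perm1.
  by rewrite addbb addbF.
have odd_phi u : sdprod_perm u = (lin_part u != 1%g) :> bool.
  rewrite /sdprod_perm odd_permM.
  have -> n : (rho ^+ n)%g = false :> bool.
    by elim: n => [|n IH]; rewrite ?odd_perm1 // expgS odd_permM odd_rot.
  by case: (_ != _); rewrite ?odd_perm1 ?odd_tperm // -val_eqE /= !inordK.
move=> u v uv; have := congr1 (@odd_perm _) uv; rewrite !odd_phi => lin_uv.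
move: uv; rewrite /sdprod_perm lin_uv => /mulIg/eqP.
rewrite eq_expg_mod_order rot_order => /eqP c_uv.
have {c_uv}: Z3_part u = Z3_part v.
  by apply: val_inj; move: c_uv; rewrite !modn_small.
case: u v lin_uv => [c m] [c' m'] /= lin_uv ->; congr Z3Sdprod.
apply/eqP; move: lin_uv.
have [->|mE] := scal2_cycle m; have [->|mE'] := scal2_cycle m' => //.
- by rewrite eqxx => /esym/negbFE/eqP->.
- by rewrite eqxx => /negbFE/eqP->.
- by move=> _; apply/eqP/val_inj; rewrite /= mE mE'.
Qed.

Lemma sdprod_isog_onto :
  isog_onto Z3_sdprod (subgroup_generated [set g0 R; g1 R]).
Proof.
apply: (@subgroup_generated_isog _ sdprod_perm).
- exact: sdprod_permM.
- exact: sdprod_perm_inj.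
- exists (Z3Sdprod 0 (subg _ scal2)).
  rewrite /sdprod_perm /= expg0 mul1g -val_eqE /= subgK ?cycle_id //.
  by rewrite scal2_neq1 expg1.
- by exists (Z3Sdprod 1 1%g); rewrite /sdprod_perm /= eqxx expg0 mulg1 expg1.
Qed.

End Generated.

(** * The action on the plane and the automorphisms of the pencil *)

Section PencilAction.
Context {R : realType}.
Implicit Types (s : 'S_3) (P Q v : R * R) (k : R).

Definition homog_coord P (i : 'I_3) : R := tnth [tuple 0; P.1; P.2] i.

Definition perm_action s P : R * R :=
  let x i := homog_coord P (s (inord i)) in (x 1%N - x 0%N, x 2%N - x 0%N).

(** The finite entries add constants to the permuted coordinates; normalising the first coordinate
    to zero turns them into a translation. *)
Lemma monomial_mx_act s (a : 'I_3 -> R) P :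
  trop_inhomog (monomial_mx s a *m trop_homog P) =
  perm_action s P +
    (a (inord 1) - a (inord 0), a (inord 2) - a (inord 0)).
Proof.
have E i : (monomial_mx s a *m trop_homog P) i 0 =
    Some (a i + homog_coord P (s i)).
  rewrite mxE (bigD1 (s i)) //= big1 => [|j js]; last first.
    by rewrite !mxE (negPf js).
  by rewrite addr0 !mxE eqxx.
rewrite /trop_inhomog !E /perm_action /=.
by congr (_, _); rewrite /trop_fin /=; ring.
Qed.

Lemma trop_act_perm s P : trop_act (tropPGL_perm R s) P = perm_action s P.
Proof.
rewrite trop_act_class /= -monomial_mx_perm monomial_mx_act.
by rewrite subrr addr0.
Qed.

Lemma homog_coord_perm s P i :
  homog_coord (perm_action s P) i = homog_coord P (s i) - homog_coord P (s (inord 0)).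
Proof.
by move: i; apply: ord3_forall; rewrite {1}/homog_coord (tnth_nth 0) inordK //= subrr.
Qed.

(** A product of permutations applies its left factor first, and reindexing coordinates reverses
    this order once more. *)
Lemma perm_actionM s s' P : perm_action (s * s')%g P = perm_action s (perm_action s' P).
Proof.
rewrite /perm_action !homog_coord_perm !permM -/(perm_action s' P).
by congr (_, _); ring.
Qed.

Lemma perm_action1 P : perm_action 1%g P = P.
Proof.
rewrite /perm_action !perm1 /homog_coord !(tnth_nth 0) !inordK //= !subr0.
by case: P.
Qed.

Lemma g0_act P : trop_act (g0 R) P = (P.2, P.1).
Proof.
have [t0 t1 t2] := swapE.
rewrite trop_act_perm /perm_action t0 t1 t2 /homog_coord !(tnth_nth 0) !inordK //=.
by rewrite !subr0.
Qed.

Lemma g1_act P : trop_act (g1 R) P = (P.2 - P.1, - P.1).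
Proof.
rewrite trop_act_perm /perm_action !rotE // /homog_coord !(tnth_nth 0) !inordK //=.
by rewrite sub0r.
Qed.

Lemma max_attained_twice_swap k P :
  max_attained_twice k P -> max_attained_twice k (P.2, P.1).
Proof.
rewrite /max_attained_twice /=; by case=> -[] [h1 h2 h3]; attained_twice.
Qed.

(** Once [3 * P.1] is added to all four terms, the substitution permutes 3X, 3Y, 0 cyclically and
    fixes k + X + Y. *)
Lemma max_attained_twice_rot k P :
  max_attained_twice k P -> max_attained_twice k (P.2 - P.1, - P.1).
Proof.
rewrite /max_attained_twice /=; by case=> -[] [h1 h2 h3]; attained_twice.
Qed.

Lemma g0_curve k : trop_act (g0 R) @` hesse_curve k = hesse_curve k.
Proof.
have sub P : hesse_curve k P -> hesse_curve k (P.2, P.1).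
  by move=> /hesse_curveP/max_attained_twice_swap/hesse_curveP.
apply/seteqP; split=> [_ [P /sub CP <-]|P /sub CP]; first by rewrite g0_act.
by exists (P.2, P.1); rewrite // g0_act; case: P {CP}.
Qed.

Lemma g1_curve k : trop_act (g1 R) @` hesse_curve k = hesse_curve k.
Proof.
have sub P : hesse_curve k P -> hesse_curve k (P.2 - P.1, - P.1).
  by move=> /hesse_curveP/max_attained_twice_rot/hesse_curveP.
(* The preimage of [P] is its image under the square of [g1], whence [sub] twice. *)
apply/seteqP; split=> [_ [P /sub CP <-]|P /sub /sub /= CP].
  by rewrite g1_act.
by eexists; [exact: CP|rewrite g1_act; case: P {CP} => x y /=; congr (_, _); ring].
Qed.

(** For [k = 0] the sides shrink to the origin and the rays along (1,1), (0,-1), (-1,0) remain, no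
    two of them opposite. *)
Lemma hesse_curve0_antipodal v : hesse_curve 0 v -> hesse_curve 0 (- v) -> v = 0.
Proof.
case: v => x y /hesse_curveP + /hesse_curveP.
rewrite /max_attained_twice /=; case=> -[] [h1 h2 h3];
  by case=> -[] [h4 h5 h6]; congr (_, _); lra.
Qed.

Lemma perm_curve s k : perm_action s @` hesse_curve k = hesse_curve k.
Proof.
have actE t : trop_act (tropPGL_perm R t) = perm_action t.
  by apply/funext => P; rewrite trop_act_perm.
move: s; apply: S3_ind => [|s t sC tC||].
- rewrite (_ : perm_action 1%g = id) ?image_id //.
  by apply/funext => P; rewrite perm_action1.
- rewrite (_ : perm_action (s * t)%g = perm_action s \o perm_action t).
    by rewrite -image_comp tC sC.
  by apply/funext => P; rewrite perm_actionM.
- by rewrite -actE g0_curve.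
- by rewrite -actE g1_curve.
Qed.

Lemma translation_curve0 v k :
  (fun P => P + v) @` hesse_curve 0 = hesse_curve k -> v = 0.
Proof.
move=> Cv; pose r P := (P.2 - P.1, - P.1) : R * R.
have rE : trop_act (g1 R) = r by apply/funext => P; rewrite g1_act.
have C00 : hesse_curve 0 (0 : R * R).
  by apply/hesse_curveP; left; constructor 1; split.
have Ckv : hesse_curve k v by rewrite -Cv; exists 0; rewrite ?add0r.
have rCk P : hesse_curve k P -> hesse_curve k (r P).
  by move=> CP; rewrite -(g1_curve k) rE; exists P.
have C1 : hesse_curve 0 (r v - v).
  by have := rCk _ Ckv; rewrite -Cv => -[P CP <-]; rewrite addrK.
(* Some [P] on the tripod satisfies [r (P + v) = v], and linearity of [r] gives [v - r v = r P]. *)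
have C2 : hesse_curve 0 (- (r v - v)).
  have := Ckv; rewrite -(g1_curve k) -{1}Cv rE => -[_ [P CP <-] vE].
  have -> : - (r v - v) = r P.
    by rewrite -{2}vE /r; congr (_, _) => /=; ring.
  by rewrite -(g1_curve 0) rE; exists P.
have := hesse_curve0_antipodal C1 C2.
by case: v {Cv Ckv C1 C2} => x y; rewrite /r => -[/= e1 e2]; congr (_, _); lra.
Qed.

Lemma pencil_aut_perm : pencil_aut R = range (@tropPGL_perm R 3).
Proof.
apply/seteqP; split=> [g gaut|_ [s _ <-] k]; last first.
  exists k; rewrite -[RHS](perm_curve s); congr image.
  by apply/funext => P; rewrite trop_act_perm.
have [s [a gE]] := trop_inverse_monomial (tropGL_inv_mxP (repr g)).
pose v := (a (inord 1) - a (inord 0), a (inord 2) - a (inord 0)).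
have [k gk] := gaut 0.
have v0 : v = 0.
  (* The permutation part of [g] preserves the tripod, so only the translation by [v] is left. *)
  apply: (@translation_curve0 v k); rewrite -gk -[in LHS](perm_curve s) image_comp.
  by congr image; apply/funext => P; rewrite /trop_act /= gE monomial_mx_act.
case: v0 => /eqP; rewrite subr_eq0 => /eqP a1 /eqP; rewrite subr_eq0 => /eqP a2.
(* A zero translation means equal finite entries: the matrix is a tropical scalar times a
   permutation matrix. *)
have a_const : forall i, a i = a (inord 0) by exact: ord3_forall.
exists s => //; rewrite -[RHS]tropPGL_repr; apply/tropPGL_classP.
exists (a (inord 0)); rewrite /= gE -monomial_mx_perm; apply/matrixP => i j.
rewrite !mxE a_const; case: eqP => _; last by [].
by congr Some; rewrite addr0.
Qed.

(** * Addition on the cycle *)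

Lemma cycle_add_V3 k t : 0 < k -> 0 <= t <= 3 * k ->
  cycle_add k (jac_param k t) (V3 k) = jac_phi (jac_class k (t - k)).
Proof.
move=> k0 t0.
have V3E : V3 k = jac_phi (jac_class k (2 * k)).
  rewrite jac_phi_class //; last lra.
  by rewrite /jac_param /V3 lexx ifN -?ltNge; [congr (_, _); ring|lra].
rewrite -jac_phi_class // V3E cycle_addE //; congr jac_phi.
rewrite /jac_class -raddfD.
(* The parameter [2 * k] of [V3] is [- k] modulo one period [3 * k]. *)
by apply/jac_classP; exists 1; rewrite mul1r; ring.
Qed.

Lemma cycle_param k P : 0 < k -> hesse_cycle k P ->
  exists2 t, 0 <= t <= 3 * k & P = jac_param k t.
Proof.
move=> k0 [/hesse_curveP CP nub].
have off_ray A u h : 0 < h -> u != 0 -> P = A + h *: u ->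
    (forall t, 0 <= t -> max_attained_twice k (A + t *: u)) -> False.
  move=> h0 u0 PE Cu; apply: nub; exists A, u; split=> //; last by exists h.
  by move=> t /Cu /hesse_curveP.
have pairE (a b c d h : R) : (a, b) + h *: (c, d) = (a + h * c, b + h * d) by [].
case: P CP off_ray {nub} => x y CP off_ray.
move: CP; rewrite {1}/max_attained_twice /=.
case=> -[] [h1 h2 h3].
(* On each half-line, either [P] is the end vertex, with parameter 0, [2 * k] or [k], or it lies
   beyond it and is removed by [off_ray]. *)
- have [xk|kx] := leP x k.
    exists 0; first lra.
    by rewrite /jac_param ltW //; congr (_, _); lra.
  exfalso; apply: (off_ray (k, k) (1, 1) (x - k)).
  + lra.
  + by apply/eqP => -[/eqP]; rewrite oner_eq0.
  + by rewrite pairE; congr (_, _); lra.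
  + by move=> t t0; rewrite pairE; left; constructor 1; split=> /=; lra.
- have [yk|ky] := leP (- k) y.
    exists (2 * k); first lra.
    by rewrite /jac_param lexx ifN -?ltNge; [congr (_, _); lra|lra].
  exfalso; apply: (off_ray (0, - k) (0, -1) (- k - y)).
  + lra.
  + by apply/eqP => -[/eqP]; rewrite oppr_eq0 oner_eq0.
  + by rewrite pairE; congr (_, _); lra.
  + by move=> t t0; rewrite pairE; left; constructor 2; split=> /=; lra.
- have [xk|kx] := leP (- k) x.
    exists k; first lra.
    by rewrite /jac_param lexx; congr (_, _); lra.
  exfalso; apply: (off_ray (- k, 0) (-1, 0) (- k - x)).
  + lra.
  + by apply/eqP => -[/eqP]; rewrite oppr_eq0 oner_eq0.
  + by rewrite pairE; congr (_, _); lra.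
  + by move=> t t0; rewrite pairE; left; constructor 3; split=> /=; lra.
(* On the sides one coordinate gives the parameter; a shared vertex falls in the earlier branch of
   [jac_param], hence the case splits. *)
- exists (2 * k + x); first lra.
  rewrite /jac_param ifN -?ltNge; last lra.
  by case: leP => ?; congr (_, _); lra.
- exists (k - y); first lra.
  by rewrite /jac_param ifT; [congr (_, _); lra|lra].
- exists (k - y); first lra.
  rewrite /jac_param; case: leP => ?; first by congr (_, _); lra.
  by rewrite ifT; [congr (_, _); lra|lra].
Qed.

(** [g1] carries each side affinely onto the preceding one, which shifts the parameter by [- k]. *)
Lemma g1_cycle_add k P : 0 < k -> hesse_cycle k P ->
  trop_act (g1 R) P = cycle_add k P (V3 k).
Proof.
move=> k0 /(cycle_param k0)[t t0 ->]; rewrite cycle_add_V3 // g1_act.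
have [tk|kt] := leP t k.
  (* Here [t - k] can be negative, so the representative one period higher is taken. *)
  have -> : jac_class k (t - k) = jac_class k (t + 2 * k).
    by apply/jac_classP; exists (-1); rewrite mulrNz mulr1z; ring.
  rewrite jac_phi_class //; last lra.
  rewrite /jac_param tk ifN -?ltNge; last lra.
  by case: leP => ?; congr (_, _) => /=; lra.
rewrite jac_phi_class //; last lra.
rewrite /jac_param [t <= k]leNgt kt /=.
have [t2|t2] := leP t (2 * k).
  by rewrite ifT; [congr (_, _) => /=; lra|lra].
rewrite ifN -?ltNge; last lra.
by rewrite ifT; [congr (_, _) => /=; lra|lra].
Qed.

Lemma g0_reflected k P : hesse_curve k P -> reflected (line_XY R) P (trop_act (g0 R) P).
Proof.
move=> _; rewrite g0_act; split=> [|A B]; rewrite /line_XY /dotp /=.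
  by rewrite addrC.
by move=> -> ->; ring.
Qed.

End PencilAction.

Theorem theorem3 (R : realType) :
  [/\ forall P, trop_act (g0 R) P = (P.2, P.1)
    & forall P, trop_act (g1 R) P = (P.2 - P.1, - P.1)] /\
  [/\ (g0 R ^+ 2 = 1)%g, (g1 R ^+ 3 = 1)%g & ((g0 R * g1 R) ^+ 2 = 1)%g] /\
  [/\ scal2 \in SL2F3,
      isog_onto (dihedral_gtype 6) (subgroup_generated [set g0 R; g1 R]),
      isog_onto Z3_sdprod (subgroup_generated [set g0 R; g1 R])
    & subgroup_generated [set g0 R; g1 R] = pencil_aut R] /\
  [/\ forall k : R,
        trop_act (g0 R) @` hesse_curve k = hesse_curve k /\
        forall P, hesse_curve k P -> reflected (line_XY R) P (trop_act (g0 R) P),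
      forall k : R, 0 < k -> line_XY R (V1 k),
      forall k : R, trop_act (g1 R) @` hesse_curve k = hesse_curve k
    & forall k : R, 0 < k -> forall P, hesse_cycle k P ->
        trop_act (g1 R) P = cycle_add k P (V3 k)].
Proof.
split; first by split=> P; [exact: g0_act|exact: g1_act].
split.
  split; first by rewrite tropPGL_permX swap_sq tropPGL_perm1.
    by rewrite tropPGL_permX rot_cube tropPGL_perm1.
  by rewrite -tropPGL_permM tropPGL_permX swap_rot_sq tropPGL_perm1.
split.
  split; [exact: scal2_SL2F3|exact: dihedral_isog_onto|exact: sdprod_isog_onto|].
  by rewrite subgroup_generated_S3 pencil_aut_perm.
split=> // k; first by split=> [|P]; [exact: g0_curve|exact: g0_reflected].
  exact: g1_curve.
by move=> k0 P; exact: g1_cycle_add.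
Qed.
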